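(* Let $\mathcal{F}$ be the feasible region of the system (S) described in the context and let $x^*\in\mathcal{F}$. Suppose that the rank of the collection of vectors $\{\nabla h_i(x^* )\}_{i=1}^m\cup\{\nabla G_i(x^* )\}_{i\in\mathcal{I}^*}\cup\{\nabla H_i(x^* )\}_{i\in\mathcal{K}^*}$ is equal to $d$. Then the error bound property holds at $x^*$: there exist $\alpha>0$ and a neighbourhood $\mathbb{U}(x^* )$ of $x^*$ such that $$d_{\mathcal{F}}(x)\le\alpha\Big(\|g_+(x)\|+\|h(x)\|+\sum_{i=1}^p d_\Omega(G_i(x),H_i(x))\Big)\qquad\text{for all }x\in\mathbb{U}(x^* )\cap C.$$
   Context: System (S): $g_i(x)\le 0$ ($i=1,\dots,n$), $h_i(x)=0$ ($i=1,\dots,m$), $(G(x),H(x))\in\Omega^p$, $x\in C$, where $\Omega^p=\{(y,z)\in\mathbb{R}^p\times\mathbb{R}^p:0\le y\perp z\ge0\}$ and $\Omega=\Omega^1$; $C=C_1\times\cdots\times C_l$ with $C_i\subseteq\mathbb{R}^{q_i}$ closed, $q_1+\cdots+q_l=d$; $g_i:\mathbb{R}^d\to\mathbb{R}$ are locally Lipschitz and $h_i:\mathbb{R}^d\to\mathbb{R}$, $G,H:\mathbb{R}^d\to\mathbb{R}^p$ are continuously differentiable at $x^*$. $g=(g_1,\dots,g_n)$, $h=(h_1,\dots,h_m)$, $g_+(x)=\max\{0,g(x)\}$ componentwise, $d_S$ denotes the distance to the set $S$, $\|\cdot\|$ denotes any norm. Index sets: $\mathcal{I}^*=\{i:0=G_i(x^*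 )<H_i(x^* )\}$, $\mathcal{K}^*=\{i:G_i(x^* )>H_i(x^* )=0\}$. *)

(* Defs.v *)
From HB Require Import structures.
From mathcomp Require Import all_boot all_order all_algebra.
From mathcomp Require Import all_classical all_reals all_analysis.

Set Implicit Arguments.
Unset Strict Implicit.
Unset Printing Implicit Defensive.

Import Order.TTheory GRing.Theory Num.Theory.
Import numFieldNormedType.Exports.

Local Open Scope classical_set_scope.
Local Open Scope ring_scope.

(* An arbitrary norm, as opposed to the canonical norm `|_| (on 'rV[R]_k, the
   maximum norm). Nonnegativity follows from the three axioms. *)
Definition is_norm (R : realType) (V : lmodType R) (N : V -> R) : Prop :=
  [/\ forall u v, N (u + v) <= N u + N v,
      forall (a : R) v, N (a *: v) = `|a| * N v
    & forall v, N v = 0 -> v = 0].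

(* As inf set0 = 0, this is the distance only when S is nonempty. *)
Definition dist (R : realType) (V : lmodType R) (N : V -> R) (S : set V)
    (x : V) : R :=
  inf [set N (x - y) | y in S].

Definition Omega (R : realType) (p : nat) : set ('rV[R]_p * 'rV[R]_p) :=
  [set yz : 'rV[R]_p * 'rV[R]_p |
     [/\ forall i, 0 <= yz.1 0 i,
         yz.1 *m yz.2^T = 0
       & forall i, 0 <= yz.2 0 i]].

(* The Cartesian product of the C_i; submxrow x i is the i-th block of x. *)
Definition block_prod (R : realType) (l : nat) (q : 'I_l -> nat)
    (C : forall i, set 'rV[R]_(q i)) : set 'rV[R]_(\sum_(i < l) q i) :=
  [set x | forall i, C i (submxrow x i)].

(* Differentiability is required on a neighbourhood of x, continuity of the
   derivative (for the operator norm) only at x. *)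
Definition cont_differentiable_at (R : realType) (V W : normedModType R)
    (f : V -> W) (x : V) : Prop :=
  (\forall y \near x, differentiable f y) /\
  (forall e : R, 0 < e ->
     \forall y \near x, forall v : V, `|'d f y v - 'd f x v| <= e * `|v|).

Definition locally_lipschitz_at (R : realType) (V W : normedModType R)
    (f : V -> W) (x : V) : Prop :=
  exists2 U : set V, nbhs x U & [lipschitz f y | y in U].

Definition gradient (R : realType) (d : nat) (f : 'rV[R]_d -> R)
    (x : 'rV[R]_d) : 'rV[R]_d :=
  \row_j 'D_(delta_mx 0 j) f x.

Definition feasible (R : realType) (d n m p : nat)
    (g : 'I_n -> 'rV[R]_d -> R) (h : 'I_m -> 'rV[R]_d -> R)
    (G H : 'rV[R]_d -> 'rV[R]_p) (C : set 'rV[R]_d) : set 'rV[R]_d :=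
  [set x | [/\ forall i, g i x <= 0,
               forall i, h i x = 0,
               Omega (G x, H x)
             & C x]].

Definition Iset (R : realType) (p : nat) (y z : 'rV[R]_p) : {set 'I_p} :=
  finset (fun i => (0 == y 0 i) && (y 0 i < z 0 i)).

Definition Kset (R : realType) (p : nat) (y z : 'rV[R]_p) : {set 'I_p} :=
  finset (fun i => (z 0 i < y 0 i) && (z 0 i == 0)).

Definition active_gradients (R : realType) (d m p : nat)
    (h : 'I_m -> 'rV[R]_d -> R) (G H : 'rV[R]_d -> 'rV[R]_p)
    (x : 'rV[R]_d) : seq 'rV[R]_d :=
  [seq gradient (h i) x | i : 'I_m]
  ++ [seq gradient (fun y => G y 0 i) x | i in Iset (G x) (H x)]
  ++ [seq gradient (fun y => H y 0 i) x | i in Kset (G x) (H x)].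

(* Main.v *)
(* The residual r(x) on the right-hand side bounds |x - xs| itself near xs,
   hence the distance to F, because xs is in F. Every active constraint function
   f (h_i, G_i on I*, H_i on K* ) vanishes at xs and satisfies |f(x)| = O(r(x)):
   near xs, the active component of (G_i, H_i) is the smaller one in absolute
   value, and this minimum is the distance to Omega up to a constant. So
   <grad f(xs), x - xs> = O(r(x)) + o(|x - xs|). This estimate is stable under
   linear combinations, and the gradients span the whole space, so it holds for
   every coordinate of x - xs; the term o(|x - xs|) is then absorbed on the
   left. *)
Require Import Defs.
From HB Require Import structures.
From mathcomp Require Import all_boot all_order all_algebra.
From mathcomp Require Import all_classical all_reals all_analysis.
From mathcomp Require Import lra.

Set Implicit Arguments.
Unset Strict Implicit.
Unset Printing Implicit Defensive.

Import Order.TTheory GRing.Theory Num.Theory.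
Import numFieldNormedType.Exports.

Local Open Scope classical_set_scope.
Local Open Scope ring_scope.


(** * Equivalence of norms on row vectors *)

Section RowVectorNorms.
Context {R : realType}.

Lemma near_norm_le (V : normedModType R) (v : V) (e : R) :
  0 < e -> \forall w \near v, `|v - w| <= e.
Proof. by move=> e0; have /cvgrPdist_le := @cvg_id _ (nbhs v); apply. Qed.

Lemma mx_norm_ge_entry (a b : nat) (v : 'M[R]_(a, b)) i j : `|v i j| <= `|v|.
Proof.
rewrite [leRHS]/Num.norm /= mx_normrE.
exact: (le_bigmax _ (fun ij : 'I_a * 'I_b => `|v ij.1 ij.2|) (i, j)).
Qed.

Lemma mx_norm_le (a b : nat) (v : 'M[R]_(a, b)) (e : R) :
  0 <= e -> (forall i j, `|v i j| <= e) -> `|v| <= e.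
Proof.
move=> e0 ve; rewrite [leLHS]/Num.norm /= mx_normrE.
by apply/bigmax_leP; split.
Qed.

Lemma is_norm0 (V : lmodType R) (N : V -> R) : is_norm N -> N 0 = 0.
Proof. by case=> _ NZ _; rewrite -(scale0r (0 : V)) NZ normr0 mul0r. Qed.

Lemma is_normN (V : lmodType R) (N : V -> R) v : is_norm N -> N (- v) = N v.
Proof. by case=> _ NZ _; rewrite -scaleN1r NZ normrN normr1 mul1r. Qed.

Lemma is_norm_ge0 (V : lmodType R) (N : V -> R) v : is_norm N -> 0 <= N v.
Proof.
move=> nN; have [ND _ _] := nN; have := ND v (- v).
by rewrite subrr is_norm0// is_normN// -mulr2n pmulrn_lge0.
Qed.

Lemma is_norm_le_mx_norm (k : nat) (N : 'rV[R]_k -> R) : is_norm N ->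
  exists2 c : R, 0 < c & forall v, N v <= c * `|v|.
Proof.
move=> nN; have [ND NZ _] := nN.
(* Expanding [v] in the standard basis gives the sum as constant; the added 1 keeps it positive when
   [k = 0]. *)
exists (1 + \sum_(j < k) N (delta_mx 0 j)).
  by rewrite ltr_pwDl// sumr_ge0// => j _; exact: is_norm_ge0.
move=> v; have Nsum (F : 'I_k -> 'rV[R]_k) : N (\sum_j F j) <= \sum_j N (F j).
  elim/big_ind2 : _ => //; first by rewrite is_norm0.
  by move=> ? ? ? ? h1 h2; exact: le_trans (ND _ _) (lerD h1 h2).
rewrite [v in leLHS]row_sum_delta mulrDl mul1r ler_wpDl//.
apply: le_trans (Nsum _) _; rewrite mulr_suml; apply: ler_sum => j _.
by rewrite NZ mulrC ler_wpM2l ?is_norm_ge0// mx_norm_ge_entry.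
Qed.

(** [N] is continuous, so it attains a minimum on the compact unit sphere of the maximum norm. This
    minimum is positive by definiteness, and homogeneity carries the bound to all vectors. *)
Lemma is_norm_ge_mx_norm (k : nat) (N : 'rV[R]_k -> R) : is_norm N ->
  exists2 c : R, 0 < c & forall v, c * `|v| <= N v.
Proof.
move=> nN; have [ND NZ N0] := nN.
pose S : set 'rV[R]_k := [set v | `|v| = 1].
have unit (v : 'rV[R]_k) : v != 0 -> S (`|v|^-1 *: v).
  by move=> v0; rewrite /S/= normrZ normfV normr_id mulVf// normr_eq0.
(* An empty sphere has no minimizer, but then 0 is the only vector and any constant works. *)
have [Se|/set0P S0] := eqVneq S set0.
  exists 1 => // v; have [->|/unit] := eqVneq v 0; last by rewrite Se.
  by rewrite normr0 mulr0 is_norm_ge0.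
have cS : compact S.
  apply: bounded_closed_compact.
    by exists 1; split => // M M1 v /= ->; exact: ltW.
  rewrite (_ : S = Num.norm @^-1` [set 1])//.
  by apply: preimage_closed => [v _|]; [exact: norm_continuous|exact: closed_eq].
have [c c0 Nc] := is_norm_le_mx_norm nN.
(* By the triangle inequality [N] varies between [v] and [w] by at most [N (v - w)], which is at
   most [c] times the maximum norm of [v - w]. *)
have Ncont : continuous N.
  move=> v; apply/(@cvgrPdist_le _ _ _ (nbhs v)) => e e0.
  have : 0 < c^-1 * e by rewrite mulr_gt0// invr_gt0.
  move=> /(near_norm_le v); apply: filterS => w.
  rewrite ler_pdivlMl// => /(le_trans (Nc _)) Nvw.
  rewrite ler_distl lerBlDr; apply/andP; split.
    rewrite -[w in leLHS](subrK v) (le_trans (ND _ _))// [leRHS]addrC lerD2r.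
    by rewrite -(is_normN (w - v))// opprB.
  by rewrite -[v in leLHS](subrK w) (le_trans (ND _ _))// [leRHS]addrC lerD2r.
have [u /set_mem Su uN] := EVT_min_rV S0 cS (continuous_subspaceT Ncont).
have u0 : u != 0 by rewrite -normr_eq0 Su oner_eq0.
exists (N u).
  rewrite lt_neqAle is_norm_ge0// andbT eq_sym.
  by apply: contra_neqN u0 => /eqP /N0.
move=> v; have [->|v0] := eqVneq v 0.
  by rewrite normr0 mulr0 is_norm_ge0.
have := uN _ (mem_set (unit _ v0)); rewrite NZ normfV normr_id.
by rewrite ler_pdivlMl ?normr_gt0// mulrC.
Qed.

(** Concatenation identifies pairs with rows of length [a + b], which reduces the claim to
    [is_norm_ge_mx_norm]. *)
Lemma is_norm_ge_pair (a b : nat) (N : 'rV[R]_a * 'rV[R]_b -> R) : is_norm N ->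
  exists2 c : R, 0 < c & forall u, c * `|u.1| <= N u /\ c * `|u.2| <= N u.
Proof.
case=> ND NZ N0.
pose N' (w : 'rV[R]_(a + b)) := N (lsubmx w, rsubmx w).
have nN' : is_norm N'.
  split=> [u v|t v|v /N0[l0 r0]]; rewrite /N'.
  - by rewrite !linearD; exact: (ND (_, _) (_, _)).
  - by rewrite !linearZ; exact: (NZ _ (_, _)).
  - by rewrite -(hsubmxK v) l0 r0 row_mx0.
have [c c0 cN] := is_norm_ge_mx_norm nN'.
exists c => // -[y z] /=; have := cN (row_mx y z).
rewrite /N' row_mxKl row_mxKr => yz; split; apply: le_trans yz;
  rewrite (ler_wpM2l (ltW c0))//; apply: mx_norm_le => // i j.
  by rewrite -(row_mxEl y z) mx_norm_ge_entry.
by rewrite -(row_mxEr y z) mx_norm_ge_entry.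
Qed.

End RowVectorNorms.

(** * Distance to a set, and to the complementarity set *)

Section Distance.
Context {R : realType}.

Lemma dist_ge0 (V : lmodType R) (N : V -> R) (S : set V) x :
  is_norm N -> 0 <= dist N S x.
Proof.
move=> nN; have [->|/set0P[y Sy]] := eqVneq S set0.
  by rewrite /dist image_set0 inf0.
apply: lb_le_inf => [|_ [z _ <-]]; last exact: is_norm_ge0.
by exists (N (x - y)), y.
Qed.

Lemma dist_le (V : lmodType R) (N : V -> R) (S : set V) x y :
  is_norm N -> S y -> dist N S x <= N (x - y).
Proof.
move=> nN Sy; apply: ge_inf; last by exists y.
by exists 0 => _ [z _ <-]; exact: is_norm_ge0.
Qed.

(** Every point of [Omega] has a zero coordinate, so its difference from [(a, b)] has an entry equal
    to [a] or to [b]. *)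
Lemma dist_Omega_ge (N : 'rV[R]_1 * 'rV[R]_1 -> R) : is_norm N ->
  exists2 c : R, 0 < c & forall a b : R,
    c * Num.min `|a| `|b| <= dist N (Omega (p := 1)) (a%:M, b%:M).
Proof.
move=> nN; have [c c0 cN] := is_norm_ge_pair nN.
exists c => // a b; apply: lb_le_inf.
  (* The origin lies in [Omega], so the infimum is over a nonempty set. *)
  exists (N ((a%:M, b%:M) - 0)), 0 => //.
  by split=> [i||i] /=; rewrite ?mxE// mul0mx.
move=> _ [[y z] [_ /= yz0 _] <-].
have [/= cy cz] := cN ((a%:M, b%:M) - (y, z)).
have /eqP : y 0 0 * z 0 0 = 0.
  by have /matrixP/(_ 0 0) := yz0; rewrite !mxE big_ord1 mxE.
rewrite mulf_eq0 => /orP[] /eqP e0.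
  apply: le_trans cy; rewrite (ler_wpM2l (ltW c0))// ge_min; apply/orP; left.
  by apply: le_trans (mx_norm_ge_entry _ 0 0); rewrite !mxE e0 subr0 mulr1n.
apply: le_trans cz; rewrite (ler_wpM2l (ltW c0))// ge_min; apply/orP; right.
by apply: le_trans (mx_norm_ge_entry _ 0 0); rewrite !mxE e0 subr0 mulr1n.
Qed.

End Distance.

(** * Directions in which the residual bounds the displacement *)

Section Controlled.
Context {R : realType} {d : nat}.
Implicit Types (u v xs : 'rV[R]_d) (r : 'rV[R]_d -> R).

Definition dot u v : R := (u *m v^T) 0 0.

(* [r] bounds [x - xs] in the direction [u], up to [o(x - xs)]. *)
Definition controlled r xs u : Prop :=
  exists2 k : R, 0 <= k & forall e : R, 0 < e ->
    \forall x \near xs, `|dot u (x - xs)| <= k * r x + e * `|x - xs|.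

Lemma controlled0 r xs : controlled r xs 0.
Proof.
exists 0 => // e e0; near=> x.
by rewrite /dot mul0mx mxE normr0 mul0r add0r mulr_ge0// ltW.
Unshelve. all: by end_near. Qed.

Lemma controlledD r xs u v :
  controlled r xs u -> controlled r xs v -> controlled r xs (u + v).
Proof.
move=> [k k0 ku] [l l0 lv]; exists (k + l); first exact: addr_ge0.
move=> e e0; have e20 : 0 < e / 2 by rewrite divr_gt0.
near=> x; rewrite /dot mulmxDl mxE (le_trans (ler_normD _ _))//.
rewrite [e]splitr !mulrDl addrACA lerD//.
  by near: x; exact: ku.
by near: x; exact: lv.
Unshelve. all: by end_near. Qed.

Lemma controlledZ r xs a u : controlled r xs u -> controlled r xs (a *: u).
Proof.
(* The factor [|a| + 1] replaces [|a|] so that [e] can be divided by it even when [a = 0]. *)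
move=> [k k0 ku]; have a0 : 0 < `|a| + 1 by rewrite ltr_wpDl.
exists ((`|a| + 1) * k); first by rewrite mulr_ge0// ltW.
move=> e e0; have ea : 0 < e / (`|a| + 1) by rewrite divr_gt0.
near=> x; rewrite /dot -scalemxAl mxE normrM.
have /(ler_wpM2l (ltW a0)) :
    `|dot u (x - xs)| <= k * r x + e / (`|a| + 1) * `|x - xs|.
  by near: x; exact: ku.
rewrite mulrDr !mulrA [_ * e]mulrC mulfK ?gt_eqF//.
by apply: le_trans; rewrite ler_wpM2r// lerDl.
Unshelve. all: by end_near. Qed.

(** The three previous lemmas say that the controlled directions form a linear subspace. *)
Lemma controlled_span r xs (X : seq 'rV[R]_d) u :
  (forall w, w \in X -> controlled r xs w) -> u \in <<X>>%VS ->
  controlled r xs u.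
Proof.
move=> cX; rewrite -[X]in_tupleE => /coord_span ->.
elim/big_ind : _ => [|v w|i _]; first exact: controlled0.
  exact: controlledD.
by apply: controlledZ; apply/cX/mem_nth.
Qed.

Lemma dot_gradient (f : 'rV[R]_d -> R) xs v :
  differentiable f xs -> dot (gradient f xs) v = 'd f xs v.
Proof.
move=> df; rewrite [v in RHS]row_sum_delta linear_sum /dot mxE.
by apply: eq_bigr => j _; rewrite linearZ !mxE deriveE// mulrC.
Qed.

(** The differential at [x - xs] is the increment of [f], bounded by [k * r x], minus the remainder
    of the first-order expansion, which is [o(x - xs)]. *)
Lemma controlled_gradient r xs (f : 'rV[R]_d -> R) (k : R) :
  differentiable f xs -> 0 <= k ->
  (\forall x \near xs, `|f x - f xs| <= k * r x) ->
  controlled r xs (gradient f xs).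
Proof.
move=> df k0 fk; exists k => // e e0.
have [_ /eqaddoP /(_ _ e0)] := (diff_locallyP _ _).1 df.
move=> fe; have {fe} : \forall x \near xs,
    `|f x - (f xs + 'd f xs (x - xs))| <= e * `|x - xs|.
  (* The little-o estimate concerns increments near 0; the shift turns it into one for points near
     [xs]. *)
  rewrite (near_shift 0); apply: filterS fe => x.
  by rewrite /= subr0 addrK !fctE.
move=> fe; near=> x; rewrite dot_gradient//.
have -> : 'd f xs (x - xs) = (f x - f xs) - (f x - (f xs + 'd f xs (x - xs))).
  by rewrite [- (f xs + _)]opprD addrA subKr.
apply: le_trans (ler_normB _ _) _; apply: lerD; near: x; [exact: fk|exact: fe].
Unshelve. all: by end_near. Qed.

(** Taking [e = 1/2] in each coordinate bounds the maximum norm of [x - xs] by a multiple of [r x]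
    plus half of itself. Moving that half to the left doubles the constant. *)
Lemma norm_le_of_controlled_delta r xs :
  (forall j, controlled r xs (delta_mx 0 j)) ->
  exists2 k : R, 0 <= k & \forall x \near xs, 0 <= r x -> `|x - xs| <= k * r x.
Proof.
move=> cd; pose P (j : 'I_d) (k : R) := 0 <= k /\
  \forall x \near xs, `|(x - xs) 0 j| <= k * r x + 2^-1 * `|x - xs|.
have /choice[k kP] j : exists k, P j k.
  have [k k0 /(_ 2^-1) kj] := cd j; exists k; split=> //.
  have := kj ltac:(by rewrite invr_gt0).
  apply: filterS => x; rewrite /dot mxE (bigD1 j)//= big1 => [|i ij].
    by rewrite addr0 !mxE !eqxx /= mul1r.
  by rewrite !mxE (negbTE ij) andbF mul0r.
have K0 : 0 <= \sum_j k j by apply: sumr_ge0 => j _; have [] := kP j.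
exists (2 * \sum_j k j); first by rewrite mulr_ge0.
have kF : \forall x \near xs, forall j,
    `|(x - xs) 0 j| <= k j * r x + 2^-1 * `|x - xs|.
  by apply: (@filter_forall _ _ _ (nbhs xs)) => j; exact: (kP j).2.
apply: filterS kF => x kx rx.
have : `|x - xs| <= (\sum_j k j) * r x + 2^-1 * `|x - xs|.
  apply: mx_norm_le => [|i j].
    by rewrite addr_ge0// mulr_ge0// invr_ge0.
  rewrite ord1 (le_trans (kx j))// lerD2r ler_wpM2r//.
  by rewrite (bigD1 j)//= lerDl sumr_ge0// => a _; have [] := kP a.
set s := (\sum_j k j) * r x => H.
rewrite -mulrA -/s; lra.
Qed.

End Controlled.

(** * Active constraints near the reference point, and the error bound *)

Lemma near_normr_lt (R : realType) (V : normedModType R) (f1 f2 : V -> R) x :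
  {for x, continuous f1} -> {for x, continuous f2} -> `|f1 x| < `|f2 x| ->
  \forall y \near x, `|f1 y| < `|f2 y|.
Proof.
move=> c1 c2 f12.
have cf : `|f2 y| - `|f1 y| @[y --> x] --> `|f2 x| - `|f1 x|.
  by apply: cvgB; apply: cvg_norm.
have f12' : 0 < `|f2 x| - `|f1 x| by rewrite subr_gt0.
by apply: filterS (cvgr_gt _ cf _ f12') => y; rewrite subr_gt0.
Qed.

Lemma cont_differentiable_at_differentiable (R : realType)
    (V W : normedModType R) (f : V -> W) x :
  cont_differentiable_at f x -> differentiable f x.
Proof. by case=> /nbhs_singleton. Qed.

Lemma differentiable_entry (R : realType) (V : normedModType R) (k : nat)
    (f : V -> 'rV[R]_k) x i :
  differentiable f x -> differentiable (fun y => f y 0 i) x.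
Proof.
by move=> df; exact: (differentiable_comp df (differentiable_coord _ 0 i)).
Qed.

Theorem theorem4p1 (R : realType) (n m p l : nat) (q : 'I_l -> nat)
    (d := (\sum_(i < l) q i)%N)
    (Ci : forall i : 'I_l, set 'rV[R]_(q i)) (C := block_prod Ci)
    (g : 'I_n -> 'rV[R]_d -> R) (h : 'I_m -> 'rV[R]_d -> R)
    (G H : 'rV[R]_d -> 'rV[R]_p) (xs : 'rV[R]_d)
    (F := feasible g h G H C)
    (Nd : 'rV[R]_d -> R) (Nn : 'rV[R]_n -> R) (Nm : 'rV[R]_m -> R)
    (N2 : 'rV[R]_1 * 'rV[R]_1 -> R) :
  is_norm Nd -> is_norm Nn -> is_norm Nm -> is_norm N2 ->
  (forall i, closed (Ci i)) ->
  (forall i, locally_lipschitz_at (g i) xs) ->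
  (forall i, cont_differentiable_at (h i) xs) ->
  cont_differentiable_at G xs ->
  cont_differentiable_at H xs ->
  F xs ->
  (\dim <<active_gradients h G H xs>>%VS = d)%N ->
  exists2 alpha : R, 0 < alpha &
    exists2 U : set 'rV[R]_d, nbhs xs U &
      forall x, (U `&` C) x ->
        dist Nd F x <=
        alpha * (Nn (\row_i Num.max 0 (g i x)) + Nm (\row_i h i x) +
                 \sum_(i < p) dist N2 (Omega (p := 1))
                                ((G x 0 i)%:M, (H x 0 i)%:M)).
Proof.
move=> nNd nNn nNm nN2 _ _ dh dG dH Fxs dimd.
have [_ hxs _ _] := Fxs.
have [cm cm0 cmN] := is_norm_ge_mx_norm nNm.
have [c c0 cN] := dist_Omega_ge nN2.
have [cd cd0 cdN] := is_norm_le_mx_norm nNd.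
pose D (i : 'I_p) (x : 'rV[R]_d) :=
  dist N2 (Omega (p := 1)) ((G x 0 i)%:M, (H x 0 i)%:M).
pose r (x : 'rV[R]_d) := Nn (\row_i Num.max 0 (g i x)) + Nm (\row_i h i x)
  + \sum_(i < p) D i x.
have D0 i x : 0 <= D i x by exact: dist_ge0.
have r0 x : 0 <= r x by rewrite !addr_ge0 ?is_norm_ge0// sumr_ge0.
have hr i x : `|h i x| <= cm^-1 * r x.
  rewrite ler_pdivlMl// (le_trans (y := Nm (\row_i h i x)))//.
    apply: le_trans (cmN _); rewrite ler_pM2l//.
    by have := mx_norm_ge_entry (\row_i h i x) 0 i; rewrite mxE.
  by rewrite /r addrAC ler_wpDl// addr_ge0 ?is_norm_ge0// sumr_ge0.
have Dr i x : c * Num.min `|G x 0 i| `|H x 0 i| <= r x.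
  apply: le_trans (cN _ _) _; rewrite -/(D i x) /r (bigD1 i)//= addrCA.
  by rewrite lerDl !addr_ge0 ?is_norm_ge0// sumr_ge0.
have dG' := cont_differentiable_at_differentiable dG.
have dH' := cont_differentiable_at_differentiable dH.
have ctrl u : u \in active_gradients h G H xs -> controlled r xs u.
  rewrite !mem_cat => /or3P[] /mapP[i].
  - move=> _ ->; apply: (controlled_gradient (k := cm^-1)).
    + exact: cont_differentiable_at_differentiable.
    + by rewrite invr_ge0 ltW.
    + by near=> x; rewrite hxs subr0.
  - rewrite mem_enum inE => /andP[/eqP G0 GH] ->.
    apply: (controlled_gradient (k := c^-1)).
    + exact: differentiable_entry.
    + by rewrite invr_ge0 ltW.
    (* This strict inequality persists near [xs] by continuity, so there the minimum in [Dr] is the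
       absolute value of the component of [G]. *)
    + have lt : `|G xs 0 i| < `|H xs 0 i|.
        by rewrite -G0 normr0 normr_gt0 gt_eqF// G0.
      have := near_normr_lt
        (differentiable_continuous (differentiable_entry i dG'))
        (differentiable_continuous (differentiable_entry i dH')) lt.
      apply: filterS => x ltx; rewrite -G0 subr0 ler_pdivlMl//.
      by have := Dr i x; rewrite min_l// ltW.
  - rewrite mem_enum inE => /andP[HG /eqP H0] ->.
    apply: (controlled_gradient (k := c^-1)).
    + exact: differentiable_entry.
    + by rewrite invr_ge0 ltW.
    + have lt : `|H xs 0 i| < `|G xs 0 i|.
        by rewrite H0 normr0 normr_gt0 gt_eqF// -H0.
      have := near_normr_lt
        (differentiable_continuous (differentiable_entry i dH'))
        (differentiable_continuous (differentiable_entry i dG')) lt.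
      apply: filterS => x ltx; rewrite H0 subr0 ler_pdivlMl//.
      by have := Dr i x; rewrite min_r// ltW.
(* A subspace of dimension [d] in a space of dimension [1 * d] is the whole space, so every basis
   vector is controlled. *)
have full : <<active_gradients h G H xs>>%VS = fullv.
  by apply/eqP; rewrite eqEdim subvf dimvf dimd dim_matrix mul1r /=.
have [k k0 xk] : exists2 k : R, 0 <= k &
    \forall x \near xs, 0 <= r x -> `|x - xs| <= k * r x.
  apply: norm_le_of_controlled_delta => j.
  by apply: controlled_span ctrl _; rewrite full memvf.
(* [cd] converts the maximum norm into [Nd]; [k] may be 0, and adding 1 makes the constant
   positive. *)
exists (cd * (k + 1)); first by rewrite mulr_gt0// ltr_wpDl.
exists [set x | 0 <= r x -> `|x - xs| <= k * r x] => // x [/(_ (r0 x)) xr _].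
(* The feasible point [xs] itself serves as competitor in the distance to [F]. *)
apply: le_trans (dist_le x nNd Fxs) _; apply: le_trans (cdN _) _.
rewrite -mulrA ler_pM2l// (le_trans xr)// -/(r x) ler_wpM2r// lerDl.
Unshelve. all: by end_near. Qed.
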